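(* Let $C$ be a coalgebra over a field. Then $C$ is a regular object in the category $\mathcal{M}^C$ of right $C$-comodules if and only if $C$ is cosemisimple.
   Context: For objects $U, M$ of a category, $M$ is called $U$-regular if every morphism $f:U\to M$ has a generalized inverse, i.e. a morphism $h:M\to U$ with $f=f\circ h\circ f$ and $h=h\circ f\circ h$ (equivalently, for every $f:U\to M$ there is $g:M\to U$ with $f=f\circ g\circ f$). Let $\mathcal{A}$ be a locally finitely generated Grothendieck category, i.e. one having a family $(U_i)_{i\in I}$ of finitely generated generators. An object $M$ of $\mathcal{A}$ is called regular if $M$ is $U_i$-regular for all $i\in I$; this does not depend on the choice of the family of finitely generated generators. The category $\mathcal{M}^C$ is a locally finitely generated Grothendieck category (the finite dimensional comodules form a generating family of finitely generated objects, up to isomorphism), and $C$ is viewed as a right $C$-comodule via its comultiplication. The coalgebra $C$ is cosemisimple if the category $\mathcal{M}^C$ is semisimple, i.e. every right $C$-comodule is a direct sum of simple comodules. *)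

(* Defs.v *)
From HB Require Import structures.
From mathcomp Require Import all_boot all_algebra.
From mathcomp Require Import boolp.

Set Implicit Arguments.
Unset Strict Implicit.
Unset Printing Implicit Defensive.

Import GRing.Theory.
Local Open Scope ring_scope.
Local Open Scope quotient_scope.

Section Category.

Record category := Category {
  obj :> Type;
  hom : obj -> obj -> Type;
  idm : forall X, hom X X;
  compm : forall X Y Z, hom Y Z -> hom X Y -> hom X Z;
  comp_idl : forall X Y (f : hom X Y), compm (idm Y) f = f;
  comp_idr : forall X Y (f : hom X Y), compm f (idm X) = f;
  comp_assoc : forall X Y Z T (h : hom Z T) (g : hom Y Z) (f : hom X Y),
    compm h (compm g f) = compm (compm h g) f }.

Variable A : category.
Implicit Types X Y Z U M : A.

Definition mono X Y (m : hom X Y) :=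
  forall Z (f g : hom Z X), compm m f = compm m g -> f = g.

Definition iso X Y (f : hom X Y) :=
  exists g : hom Y X, compm g f = idm X /\ compm f g = idm Y.

Definition zero_object X :=
  forall Y, (exists! f : hom X Y, True) /\ (exists! f : hom Y X, True).

Definition simple_object X :=
  ~ zero_object X /\
  forall Y (m : hom Y X), mono m -> zero_object Y \/ iso m.

Definition is_coproduct (J : Type) (S : J -> A) X
    (inj : forall j, hom (S j) X) :=
  forall Z (g : forall j, hom (S j) Z),
    exists! u : hom X Z, forall j, compm u (inj j) = g j.

Definition semisimple_category :=
  forall X, exists (J : Type) (S : J -> A) (inj : forall j, hom (S j) X),
    (forall j, simple_object (S j)) /\ is_coproduct inj.

(* The order on subobjects of X. *)
Definition factors_through X Y Z (m : hom Y X) (n : hom Z X) :=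
  exists h : hom Y Z, m = compm n h.

(* X is finitely generated: if X is the sum of a (nonempty) directed family of
   subobjects, i.e. no proper subobject contains them all, then X is equal to
   one of them. *)
Definition finitely_generated X :=
  forall (J : Type) (Y : J -> A) (m : forall j, hom (Y j) X),
    inhabited J ->
    (forall j, mono (m j)) ->
    (forall i j, exists k,
       factors_through (m i) (m k) /\ factors_through (m j) (m k)) ->
    (forall Z (n : hom Z X),
       mono n -> (forall j, factors_through (m j) n) -> iso n) ->
    exists j, iso (m j).

Definition generating (I : Type) (U : I -> A) :=
  forall X Y (f g : hom X Y),
    (forall i (u : hom (U i) X), compm f u = compm g u) -> f = g.

Definition fg_generators (I : Type) (U : I -> A) :=
  (forall i, finitely_generated (U i)) /\ generating U.

Definition regular_wrt U M :=
  forall f : hom U M, exists h : hom M U,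
    f = compm f (compm h f) /\ h = compm h (compm f h).

(* Meant for a locally finitely generated Grothendieck category, where it does
   not depend on the choice of the family U. *)
Definition regular_object M :=
  exists (I : Type) (U : I -> A),
    fg_generators U /\ forall i, regular_wrt (U i) M.

End Category.

(* The tensor product of two vector spaces: finite formal sums of pairs (v, w),
   represented by sequences, modulo the congruence generated by bilinearity. *)
Section Tensor.

Variables (K : fieldType) (V W : lmodType K).

Inductive tens_cong : seq (V * W) -> seq (V * W) -> Prop :=
| tens_refl s : tens_cong s s
| tens_sym s t : tens_cong s t -> tens_cong t s
| tens_trans s t u : tens_cong s t -> tens_cong t u -> tens_cong s u
| tens_cat s s' t t' :
    tens_cong s s' -> tens_cong t t' -> tens_cong (s ++ t) (s' ++ t')
| tens_catC s t : tens_cong (s ++ t) (t ++ s)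
| tens_zero w : tens_cong [:: (0, w)] [::]
| tens_addl v v' w : tens_cong [:: (v + v', w)] [:: (v, w); (v', w)]
| tens_addr v w w' : tens_cong [:: (v, w + w')] [:: (v, w); (v, w')]
| tens_scale a v w : tens_cong [:: (a *: v, w)] [:: (v, a *: w)].

Definition tens_eq (s t : seq (V * W)) : bool := `[< tens_cong s t >].

Lemma tens_eq_refl : reflexive tens_eq.
Proof. by move=> s; apply/asboolP/tens_refl. Qed.

Lemma tens_eq_sym : symmetric tens_eq.
Proof. by move=> s t; apply/asboolP/asboolP; apply: tens_sym. Qed.

Lemma tens_eq_trans : transitive tens_eq.
Proof.
move=> t s u /asboolP st /asboolP tu; apply/asboolP; exact: tens_trans st tu.
Qed.

Canonical tens_equiv := EquivRel tens_eq tens_eq_refl tens_eq_sym tens_eq_trans.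

Definition tens := {eq_quot tens_eq}.

HB.instance Definition _ : EqQuotient _ tens_eq tens := EqQuotient.on tens.
HB.instance Definition _ := Choice.on tens.

Lemma tens_piP (s t : seq (V * W)) :
  tens_cong s t <-> \pi_tens s = \pi_tens t.
Proof.
split=> [st | /eqmodP /asboolP //].
by apply/eqmodP; apply/asboolP.
Qed.

Lemma tens_reprP (s : seq (V * W)) : tens_cong (repr (\pi_tens s)) s.
Proof. by apply/tens_piP; rewrite reprK. Qed.

Definition tens_scale_seq (a : K) (s : seq (V * W)) :=
  [seq (a *: p.1, p.2) | p <- s].

Lemma tens_scale_cong a s t :
  tens_cong s t -> tens_cong (tens_scale_seq a s) (tens_scale_seq a t).
Proof.
rewrite /tens_scale_seq.
elim=> {s t} /= [s|s t _|s t u _ st _|s s' t t' _ ss' _ tt'|s t|w|v v' w|v w w'|b v w].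
- exact: tens_refl.
- exact: tens_sym.
- exact: tens_trans.
- by rewrite !map_cat; apply: tens_cat.
- by rewrite !map_cat; apply: tens_catC.
- by rewrite scaler0; apply: tens_zero.
- by rewrite scalerDr; apply: tens_addl.
- exact: tens_addr.
- by rewrite scalerA mulrC -scalerA; apply: tens_scale.
Qed.

Definition tens0 : tens := \pi_tens [::].
Definition tens_add := lift_op2 tens cat.
Definition tens_scaler (a : K) := lift_op1 tens (tens_scale_seq a).
Definition tens_opp (x : tens) : tens := tens_scaler (-1) x.

Lemma tens_addE s t : tens_add (\pi_tens s) (\pi_tens t) = \pi_tens (s ++ t).
Proof. by unlock tens_add; apply/tens_piP/tens_cat; apply: tens_reprP. Qed.

Lemma tens_scalerE a s : tens_scaler a (\pi_tens s) = \pi_tens (tens_scale_seq a s).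
Proof. by unlock tens_scaler; apply/tens_piP/tens_scale_cong/tens_reprP. Qed.

Lemma tens_addA : associative tens_add.
Proof.
move=> x y z; elim/quotW: x => s; elim/quotW: y => t; elim/quotW: z => u.
by rewrite !tens_addE catA.
Qed.

Lemma tens_addC : commutative tens_add.
Proof.
move=> x y; elim/quotW: x => s; elim/quotW: y => t.
by rewrite !tens_addE; apply/tens_piP/tens_catC.
Qed.

Lemma tens_add0 : left_id tens0 tens_add.
Proof. by move=> x; elim/quotW: x => s; rewrite tens_addE. Qed.

Lemma tens_scalerDl x a b :
  tens_scaler (a + b) x = tens_add (tens_scaler a x) (tens_scaler b x).
Proof.
elim/quotW: x => s; rewrite !tens_scalerE tens_addE; apply/tens_piP.
elim: s => [|[v w] s IHs] /=; first exact: tens_refl.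
rewrite scalerDl -cat1s.
apply: tens_trans (tens_cat (tens_addl _ _ _) IHs) _ => /=.
rewrite -[_ :: _ :: _]cat1s -[X in tens_cong _ X]cat1s.
apply: tens_cat; first exact: tens_refl.
rewrite -cat1s catA -[X in tens_cong _ (_ ++ X)]cat1s catA.
by apply: tens_cat; [apply: tens_catC | apply: tens_refl].
Qed.

Lemma tens_scaler0 x : tens_scaler 0 x = tens0.
Proof.
elim/quotW: x => s; rewrite tens_scalerE; apply/tens_piP.
elim: s => [|[v w] s IHs] /=; first exact: tens_refl.
by rewrite scale0r -cat1s; apply: tens_cat (tens_zero w) IHs.
Qed.

Lemma tens_scalerA a b x :
  tens_scaler a (tens_scaler b x) = tens_scaler (a * b) x.
Proof.
elim/quotW: x => s; rewrite !tens_scalerE /tens_scale_seq -map_comp.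
by congr (\pi_tens _); apply: eq_map => p /=; rewrite scalerA.
Qed.

Lemma tens_scaler1 : left_id 1 tens_scaler.
Proof.
move=> x; elim/quotW: x => s; rewrite tens_scalerE; congr (\pi_tens _).
by rewrite -[RHS]map_id; apply: eq_map => -[v w] /=; rewrite scale1r.
Qed.

Lemma tens_scalerDr : right_distributive tens_scaler tens_add.
Proof.
move=> a x y; elim/quotW: x => s; elim/quotW: y => t.
by rewrite tens_addE !tens_scalerE tens_addE -map_cat.
Qed.

Lemma tens_addN : left_inverse tens0 tens_opp tens_add.
Proof.
move=> x; rewrite /tens_opp -[X in tens_add _ X]tens_scaler1.
by rewrite -tens_scalerDl addNr tens_scaler0.
Qed.

HB.instance Definition _ := GRing.isZmodule.Build tens
  tens_addA tens_addC tens_add0 tens_addN.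

Lemma tens_scalerDl' x : {morph tens_scaler^~ x : a b / a + b}.
Proof. exact: tens_scalerDl. Qed.

HB.instance Definition _ := GRing.Zmodule_isLmodule.Build K tens
  tens_scalerA tens_scaler1 tens_scalerDr tens_scalerDl'.

Lemma tens_piD s t : \pi_tens s + \pi_tens t = \pi_tens (s ++ t).
Proof. exact: tens_addE. Qed.

Lemma tens_piZ a s : a *: \pi_tens s = \pi_tens (tens_scale_seq a s).
Proof. exact: tens_scalerE. Qed.

Definition tensor (v : V) (w : W) : tens := \pi_tens [:: (v, w)].

(* The linear map induced by f, computed on a chosen representative; this is
   meaningful only for bilinear f, see tens_liftE and tens_lift_linear. *)
Definition tens_lift (T : lmodType K) (f : V -> W -> T) (x : tens) : T :=
  \sum_(p <- repr x) f p.1 p.2.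

Lemma tensorP (x : tens) : x = \sum_(p <- repr x) tensor p.1 p.2.
Proof.
rewrite -[LHS]reprK; elim: (repr x) => [|[v w] s IHs]; first by rewrite big_nil.
by rewrite big_cons -IHs tens_piD.
Qed.

Section Universal.

Variables (T : lmodType K) (f : V -> W -> T).
Hypotheses (fl : forall w, linear (f^~ w)) (fr : forall v, linear (f v)).

Let fl0 w : f 0 w = 0.
Proof. by have := fl w (-1) 0 0; rewrite scaler0 addr0 scaleN1r addNr. Qed.

Let fr0 v : f v 0 = 0.
Proof. by have := fr v (-1) 0 0; rewrite scaler0 addr0 scaleN1r addNr. Qed.

Lemma tens_lift_cong s t :
  tens_cong s t -> \sum_(p <- s) f p.1 p.2 = \sum_(p <- t) f p.1 p.2.
Proof.
elim=> {s t} //=.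
- by move=> s t u _ -> _ ->.
- by move=> s s' t t' _ e _ e'; rewrite !big_cat /= e e'.
- by move=> s t; rewrite !big_cat /= addrC.
- by move=> w; rewrite big_seq1 big_nil.
- move=> v v' w; rewrite !big_cons !big_nil !addr0 /=.
  by have := fl w 1 v v'; rewrite !scale1r.
- move=> v w w'; rewrite !big_cons !big_nil !addr0 /=.
  by have := fr v 1 w w'; rewrite !scale1r.
- move=> a v w; rewrite !big_seq1 /=.
  have := fl w a v 0; have := fr v a w 0.
  by rewrite /= !addr0 fl0 fr0 !addr0 => -> ->.
Qed.

Lemma tens_lift_pi s : tens_lift f (\pi_tens s) = \sum_(p <- s) f p.1 p.2.
Proof. exact/tens_lift_cong/tens_reprP. Qed.

Lemma tens_liftE v w : tens_lift f (tensor v w) = f v w.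
Proof. by rewrite tens_lift_pi big_seq1. Qed.

Lemma tens_lift_linear : linear (tens_lift f).
Proof.
move=> a x y; elim/quotW: x => s; elim/quotW: y => t.
rewrite tens_piZ tens_piD !tens_lift_pi big_cat /= scaler_sumr big_map; congr (_ + _).
apply: eq_bigr => -[v w] _ /=.
by have := fl w a v 0; rewrite addr0 fl0 addr0.
Qed.

End Universal.

Lemma tensor_linearl w : linear (tensor^~ w).
Proof.
by move=> a v v'; rewrite /tensor tens_piZ tens_piD; apply/tens_piP/tens_addl.
Qed.

Lemma tensor_linearr v : linear (tensor v).
Proof.
move=> a w w'; rewrite /tensor tens_piZ tens_piD; apply/tens_piP.
apply: tens_trans (tens_addr _ _ _) _; rewrite -cat1s.
by apply: tens_cat; [apply/tens_sym/tens_scale | apply: tens_refl].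
Qed.

End Tensor.

Arguments tens {K} (V W)%_type_scope.
Arguments tensor {K V W} v w.

Notation "V ⊗ W" := (tens V W) (at level 40, left associativity) : type_scope.

Section TensorMaps.

Variable K : fieldType.
Implicit Types U V W : lmodType K.

Definition tens_map V W V' W' (f : V -> V') (g : W -> W') : V ⊗ W -> V' ⊗ W' :=
  tens_lift (fun v w => tensor (f v) (g w)).

Definition tens_assoc U V W : (U ⊗ V) ⊗ W -> U ⊗ (V ⊗ W) :=
  tens_lift (fun x w => tens_lift (fun u v => tensor u (tensor v w)) x).

Definition tens_unitl V : K^o ⊗ V -> V :=
  tens_lift (fun (a : K^o) (v : V) => (a : K) *: v).
Definition tens_unitr V : V ⊗ K^o -> V :=
  tens_lift (fun (v : V) (a : K^o) => (a : K) *: v).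

Lemma tens_assocE U V W (u : U) (v : V) (w : W) :
  tens_assoc (tensor (tensor u v) w) = tensor u (tensor v w).
Proof.
pose b (w' : W) (u' : U) (v' : V) := tensor u' (tensor v' w').
have bl w' v' : linear ((b w')^~ v') by move=> a u1 u2; rewrite /b tensor_linearl.
have br w' u' : linear (b w' u').
  by move=> a v1 v2; rewrite /b tensor_linearl tensor_linearr.
rewrite /tens_assoc tens_liftE ?(tens_liftE (bl w) (br w)) // => [w'|x].
  exact: (tens_lift_linear (bl w') (br w')).
move=> a w1 w2; rewrite /tens_lift scaler_sumr -big_split /=.
by apply: eq_bigr => p _; rewrite !tensor_linearr.
Qed.

Lemma tens_unitlE V (a : K) (v : V) :
  tens_unitl (tensor (a : K^o) v) = a *: v.
Proof.
rewrite /tens_unitl tens_liftE // => [w b c d|b c w w'].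
  by rewrite scalerDl scalerA.
by rewrite scalerDr !scalerA mulrC.
Qed.

Lemma tens_unitrE V (a : K) (v : V) :
  tens_unitr (tensor v (a : K^o)) = a *: v.
Proof.
rewrite /tens_unitr tens_liftE // => [b c w w'|w b c d].
  by rewrite scalerDr !scalerA mulrC.
by rewrite scalerDl scalerA.
Qed.

Section Linear.

Variables (V V' W W' : lmodType K) (f : {linear V -> V'}) (g : {linear W -> W'}).

Let bil (v : V) (w : W) := tensor (f v) (g w).

Let bill w : linear (bil^~ w).
Proof. by move=> a v v'; rewrite /bil linearP tensor_linearl. Qed.

Let bilr v : linear (bil v).
Proof. by move=> a w w'; rewrite /bil linearP tensor_linearr. Qed.

Lemma tens_mapE v w : tens_map f g (tensor v w) = tensor (f v) (g w).
Proof. exact: (tens_liftE bill bilr). Qed.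

Lemma tens_map_linear : linear (tens_map f g).
Proof. exact: (tens_lift_linear bill bilr). Qed.

HB.instance Definition _ :=
  GRing.isLinear.Build K (V ⊗ W) (V' ⊗ W') _ (tens_map f g) tens_map_linear.

End Linear.

Lemma tens_map_id V W (x : V ⊗ W) : tens_map id id x = x.
Proof. by rewrite [RHS]tensorP. Qed.

Lemma tens_map_comp (V V' V'' W : lmodType K)
    (g : {linear V' -> V''}) (f : {linear V -> V'}) (x : V ⊗ W) :
  tens_map (g \o f) id x = tens_map g id (tens_map f id x).
Proof.
rewrite [tens_map f id x]/tens_map /tens_lift (linear_sum (tens_map g idfun)).
by apply: eq_bigr => p _; exact: esym (tens_mapE g idfun _ _).
Qed.

End TensorMaps.

Record coalgebra (K : fieldType) := Coalgebra {
  coalg_space :> lmodType K;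
  comul : {linear coalg_space -> coalg_space ⊗ coalg_space};
  counit : {linear coalg_space -> K^o};
  comul_assoc : forall c,
    tens_assoc (tens_map comul id (comul c)) = tens_map id comul (comul c);
  comul_counitl : forall c, tens_unitl (tens_map counit id (comul c)) = c;
  comul_counitr : forall c, tens_unitr (tens_map id counit (comul c)) = c }.

Section Comodules.

Variables (K : fieldType) (C : coalgebra K).

(* Right C-comodules. *)
Record comodule := Comodule {
  comod_space :> lmodType K;
  coact : {linear comod_space -> comod_space ⊗ C};
  coact_assoc : forall m,
    tens_assoc (tens_map coact id (coact m))
      = tens_map id (comul C) (coact m);
  coact_counit : forall m,
    tens_unitr (tens_map id (counit C) (coact m)) = m }.

Record comod_hom (M N : comodule) := ComodHom {
  comod_fun :> {linear M -> N};
  comod_funP :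
    forall m, coact N (comod_fun m) = tens_map comod_fun id (coact M m) }.

Lemma comod_hom_eq M N (f g : comod_hom M N) : f =1 g -> f = g.
Proof.
case: f g => [f Pf] [g Pg] /= fg.
have {}fg : f = g :> {linear M -> N}.
  case: f g fg {Pf Pg} => [f cf] [g cg] /= /funext fg.
  case: g / fg cg => cg; congr GRing.Linear.Pack.
  case: cf cg => [[a] [b]] [[a'] [b']].
  by rewrite (Prop_irrelevance a a') (Prop_irrelevance b b').
by case: g / fg Pg => Pg; rewrite (Prop_irrelevance Pf Pg).
Qed.

Definition comod_id M : comod_hom M M :=
  @ComodHom M M idfun (fun m => esym (tens_map_id (coact M m))).

Lemma comod_compP M N P (g : comod_hom N P) (f : comod_hom M N) m :
  coact P ((g \o f) m) = tens_map (g \o f) id (coact M m).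
Proof. by rewrite tens_map_comp -!comod_funP. Qed.

Definition comod_comp M N P (g : comod_hom N P) (f : comod_hom M N) :
  comod_hom M P := @ComodHom M P (g \o f) (comod_compP g f).

Definition comodules : category.
Proof.
refine (@Category comodule comod_hom comod_id comod_comp _ _ _).
- by move=> M N f; apply: comod_hom_eq.
- by move=> M N f; apply: comod_hom_eq.
- by move=> M N P Q h g f; apply: comod_hom_eq.
Defined.

Definition coalg_comodule : comodule :=
  @Comodule C (comul C) (@comul_assoc K C) (@comul_counitr K C).

Definition cosemisimple := semisimple_category comodules.

End Comodules.

(* Main.v *)
(* For a functional phi on C and a right comodule M, phi . m := (id (x) phi)(rho m)
   turns M into a module over the dual algebra C^*; subcomodules are the stable
   subspaces and comodule maps are the equivariant linear maps. Each functional
   lam on M gives a comodule map m |-> (lam (x) id)(rho m) from M to C, from which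
   lam is recovered by the counit: maps to C separate a subcomodule from any
   vector outside it.

   If C is regular with respect to generators U_i, then each U_i, being finitely
   generated, is finite-dimensional, so a subcomodule of U_i is a finite
   intersection of kernels of maps to C. Generalized inverses of such maps split
   off these kernels one at a time, so every subcomodule of U_i is a direct
   summand, and a maximal subcomodule avoiding a vector has a simple complement.
   As the U_i generate, every comodule is the sum of its simple subcomodules, and a
   maximal independent family of these exhibits it as a coproduct.

   If C is cosemisimple, the simple comodules are finitely generated generators,
   and a nonzero map f from a simple comodule to C is split: a subcomodule maximal
   among those missing a nonzero value of f is a complement of the image of f. *)
Require Import Defs.
From HB Require Import structures.
From mathcomp Require Import all_boot all_algebra.
From mathcomp Require Import boolp classical_sets.

Set Implicit Arguments.
Unset Strict Implicit.
Unset Printing Implicit Defensive.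

Import GRing.Theory.
Local Open Scope ring_scope.

(** * Linear algebra over a field *)

Section LinearAlgebra.

Variable K : fieldType.

Definition mklin (V W : lmodType K) (f : V -> W) (lin_f : linear f) :
  {linear V -> W} := HB.pack f (GRing.isLinear.Build K V W *:%R f lin_f).

Definition subspace (V : lmodType K) (N : V -> Prop) :=
  N 0 /\ forall a x y, N x -> N y -> N (a *: x + y).

Section Subspace.

Variables (V : lmodType K) (N : V -> Prop).
Hypothesis subN : subspace N.

Lemma subspaceD x y : N x -> N y -> N (x + y).
Proof. by case: subN => _ H Nx Ny; rewrite -(scale1r x); apply: H. Qed.

Lemma subspaceZ a x : N x -> N (a *: x).
Proof. by case: subN => N0 H Nx; rewrite -(addr0 (_ *: _)); apply: H. Qed.

Lemma subspaceN x : N x -> N (- x).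
Proof. by rewrite -scaleN1r; apply: subspaceZ. Qed.

Lemma subspaceB x y : N x -> N y -> N (x - y).
Proof. by move=> Nx Ny; apply/subspaceD/subspaceN. Qed.

Lemma subspace_sum (I : Type) (r : seq I) (P : pred I) (F : I -> V) :
  (forall i, P i -> N (F i)) -> N (\sum_(i <- r | P i) F i).
Proof.
by move=> NF; apply: big_ind => //; [case: subN | apply: subspaceD].
Qed.

Definition sub_pred : {pred V} := fun x => `[< N x >].

Lemma sub_pred_submod : submod_closed sub_pred.
Proof.
by split=> [|a x y /asboolP Nx /asboolP Ny]; apply/asboolP; case: subN => // _; apply.
Qed.

End Subspace.

Lemma subspace_zero (V : lmodType K) : subspace (fun v : V => v = 0).
Proof. by split=> // a x y -> ->; rewrite scaler0 addr0. Qed.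

Lemma subspace_add (V : lmodType K) (N T : V -> Prop) :
  subspace N -> subspace T -> subspace (fun v => exists2 t, T t & N (v - t)).
Proof.
move=> sN sT; split; first by exists 0; rewrite ?subr0; case: sN sT => ? _ [].
move=> a x y [t Tt Nt] [s Ts Ns]; exists (a *: t + s); first by case: sT => _; apply.
by rewrite opprD addrACA -scalerBr; case: sN => _; apply.
Qed.

Definition stable (V : lmodType K) (F : Type) (op : F -> V -> V) (N : V -> Prop) :=
  forall i x, N x -> N (op i x).

(** Zorn's lemma for subspaces stable under a family of operators: the empty family gives plain
    subspaces, the action of functionals gives subcomodules. *)
Lemma maximal_avoiding (V : lmodType K) (F : Type) (op : F -> V -> V)
    (N : V -> Prop) x :
  subspace N -> stable op N -> ~ N x ->
  exists M : V -> Prop, [/\ subspace M, stable op M, forall v, N v -> M v, ~ M x &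
    forall T : V -> Prop, subspace T -> stable op T -> (forall v, M v -> T v) ->
      ~ T x -> forall v, T v -> M v].
Proof.
move=> sN stN Nx.
pose good (M : set V) := [/\ subspace M, stable op M, forall v, N v -> M v & ~ M x].
have goodN : good N by [].
have [| M [PM maxM]] := @Zorn_bigcup V (fun M => M = set0 \/ good M).
  move=> H sub_H tot_H.
  have [[M HM Mn0]|no] := pselect (exists2 M, H M & M <> set0); last first.
    left; apply/seteqP; split=> // v [M HM Mv]; case: no; exists M => // M0.
    by rewrite M0 in Mv.
  have goodM M' v : H M' -> M' v -> good M'.
    by move=> /sub_H [-> []|].
  have gM : good M by case: (sub_H _ HM).
  right; split.
  - split; first by exists M => //; case: gM => -[].
    move=> a v w [M1 H1 v1] [M2 H2 w2].
    have [M12|M21] := tot_H _ _ H1 H2.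
      exists M2 => //; have [[_ cl] _ _ _] := goodM _ _ H2 w2.
      by apply: cl => //; apply: M12.
    exists M1 => //; have [[_ cl] _ _ _] := goodM _ _ H1 v1.
    by apply: cl => //; apply: M21.
  - move=> i v [M1 H1 v1]; exists M1 => //.
    by have [_ st _ _] := goodM _ _ H1 v1; apply: st.
  - by move=> v Nv; exists M => //; case: gM => _ _ NM _; apply: NM.
  - by move=> [M1 H1 v1]; have [_ _ _] := goodM _ _ H1 v1; apply.
have {PM} gM : good M.
  case: PM => // M0; case: (maxM N); last by right.
  rewrite M0; split; first by move=> v [].
  by move=> /(_ 0); apply; case: sN.
case: (gM) => sM stM NM Mx; exists M; split=> // T sT stT MT Tx v Tv.
apply: contrapT => nMv; case: (maxM T); last by right; split=> // w /NM /MT.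
by split=> [|/(_ v Tv)].
Qed.

(** A maximal subspace [M] above [N] missing [x] is a complement of the line through [x], and
    [phi v] is the unique [a] with [v - a *: x] in [M]. *)
Lemma separating_functional (V : lmodType K) (N : V -> Prop) x :
  subspace N -> ~ N x ->
  exists phi : {linear V -> K^o}, (forall v, N v -> phi v = 0) /\ phi x = 1.
Proof.
move=> sN Nx.
have [//|M [sM _ NM Mx maxM]] :=
  maximal_avoiding (op := fun (i : void) (v : V) => v) sN _ Nx.
have dec v : exists a, M (v - a *: x).
  have [Mv|nMv] := pselect (M v); first by exists 0; rewrite scale0r subr0.
  (* For [v] outside [M], the space [T] spanned by [M] and [v] contains [x] by maximality, and the
     relation is solved for [v]. *)
  pose T w := exists a, M (w - a *: v).
  have sT : subspace T.
    split; first by exists 0; rewrite scale0r subr0; case: sM.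
    move=> a y z [b Mb] [c Mc]; exists (a * b + c).
    by rewrite scalerDl -scalerA opprD addrACA -scalerBr; case: sM => _; apply.
  have MT w : M w -> T w by exists 0; rewrite scale0r subr0.
  have Tv : T v by exists 1; rewrite scale1r subrr; case: sM.
  have [[a Ma]|nTx] := pselect (T x); last first.
    by case: nMv; apply: (maxM T).
  have an0 : a != 0 by apply/eqP => a0; apply: Mx; move: Ma; rewrite a0 scale0r subr0.
  exists a^-1.
  have -> : v - a^-1 *: x = - a^-1 *: (x - a *: v).
    by rewrite scalerBr !scaleNr opprK scalerA mulVf // scale1r addrC.
  exact: subspaceZ.
have uni v a b : M (v - a *: x) -> M (v - b *: x) -> a = b.
  move=> Ma Mb; apply/eqP; rewrite -subr_eq0; apply/negPn/negP => ab; apply: Mx.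
  have -> : x = (a - b)^-1 *: ((v - b *: x) - (v - a *: x)).
    have -> : v - b *: x - (v - a *: x) = (a - b) *: x.
      by rewrite opprB addrC addrA subrK scalerBl.
    by rewrite scalerA mulVf // scale1r.
  by apply: subspaceZ => //; apply: subspaceB.
have [phi phiP] := choice dec.
have lin_phi : linear (phi : V -> K^o).
  move=> a v w; apply: (uni (a *: v + w)) => //.
  rewrite scalerDl -scalerA opprD addrACA -scalerBr.
  by case: sM => _; apply.
exists (mklin lin_phi); split=> [v Nv|] /=.
  by apply: (uni v); rewrite // scale0r subr0; apply: NM.
by apply: (uni x); rewrite // scale1r subrr; case: sM.
Qed.

Lemma functional_eq0 (V : lmodType K) (v : V) :
  (forall phi : {linear V -> K^o}, phi v = 0) -> v = 0.
Proof.
move=> v0; apply: contrapT => vn0.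
have [phi [_ phi1]] := separating_functional (subspace_zero V) vn0.
by move/eqP: (v0 phi); rewrite phi1 oner_eq0.
Qed.

Definition dual_sum (V : lmodType K) (D : seq ({linear V -> K^o} * V)) (v : V) : V :=
  \sum_(d <- D) (d.1 v : K) *: d.2.

Lemma dual_sum_linear (V : lmodType K) (D : seq ({linear V -> K^o} * V)) :
  linear (dual_sum D).
Proof.
move=> a v w; rewrite /dual_sum scaler_sumr -big_split /=; apply: eq_bigr => d _.
by rewrite linearP scalerDl scalerA.
Qed.

Lemma dual_sum0 (V : lmodType K) (D : seq ({linear V -> K^o} * V)) v :
  all (fun d : {linear V -> K^o} * V => d.1 v == 0) D -> dual_sum D v = 0.
Proof.
elim: D => [|d D IHD] /=; first by rewrite /dual_sum big_nil.
by case/andP=> /eqP d0 /IHD; rewrite /dual_sum big_cons d0 scale0r add0r.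
Qed.

(** The functionals vanish on [N] and reproduce the vectors of [s] modulo [N], so their common zeros
    in the span of [s] lie in [N]. Induction on [s]: a vector not yet reproduced contributes its
    residue, with a functional detecting it. *)
Lemma dual_basis_mod (V : lmodType K) (N : V -> Prop) (s : seq V) :
  subspace N ->
  exists D : seq ({linear V -> K^o} * V),
    (forall v, N v -> all (fun d : {linear V -> K^o} * V => d.1 v == 0) D) /\
    (forall v, v \in s -> N (v - dual_sum D v)).
Proof.
move=> sN; elim: s => [|w s [D [DN Ds]]]; first by exists [::].
have [Nw|nNw] := pselect (N (w - dual_sum D w)).
  by exists D; split=> // v; rewrite inE => /orP[/eqP->|/Ds].
have [chi [chiN chi1]] := separating_functional sN nNw.
have lin_psi : linear (fun v => chi (v - dual_sum D v)).
  move=> a x y; rewrite dual_sum_linear opprD addrACA -scalerBr.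
  exact: linearP.
(* The new functional is [chi] after the residue map, so it kills the vectors already treated, whose
   residues lie in [N]. *)
exists ((mklin lin_psi, w - dual_sum D w) :: D); split=> [v Nv /=|v].
  by rewrite DN // andbT dual_sum0 ?DN // subr0 chiN.
rewrite inE /dual_sum big_cons /= -/(dual_sum D v) => /orP[/eqP-> | vs].
  by rewrite chi1 scale1r subrK subrr; case: sN.
by rewrite (chiN _ (Ds v vs)) scale0r add0r; apply: Ds.
Qed.

Lemma dual_basis (V : lmodType K) (s : seq V) :
  exists D : seq ({linear V -> K^o} * V), forall v, v \in s -> v = dual_sum D v.
Proof.
have [D [_ DP]] := dual_basis_mod s (subspace_zero V).
by exists D => v /DP /eqP; rewrite subr_eq0 => /eqP.
Qed.

End LinearAlgebra.

(** * Slices of tensors *)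

Section Slices.

Variable K : fieldType.
Implicit Types U V W : lmodType K.

Lemma tens_indP V W (P : V ⊗ W -> Prop) :
  P 0 -> (forall x y, P x -> P y -> P (x + y)) ->
  (forall v w, P (tensor v w)) -> forall x, P x.
Proof. by move=> P0 PD PT x; rewrite (tensorP x); apply: big_ind. Qed.

Lemma tens_linear_ext V W (T : lmodType K) (f g : V ⊗ W -> T) :
  linear f -> linear g -> (forall v w, f (tensor v w) = g (tensor v w)) -> f =1 g.
Proof.
move=> lf lg fg; have f0 := linear0 (mklin lf); have g0 := linear0 (mklin lg).
have fD := linearD (mklin lf); have gD := linearD (mklin lg).
rewrite /= in f0 g0 fD gD.
apply: tens_indP => // [|x y fgx fgy]; first by rewrite f0 g0.
by rewrite fD gD fgx fgy.
Qed.

Definition slice V W (phi : {linear W -> K^o}) : V ⊗ W -> V :=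
  tens_lift (fun v w => (phi w : K) *: v).

Definition slicel V W (lam : {linear V -> K^o}) : V ⊗ W -> W :=
  tens_lift (fun v w => (lam v : K) *: w).

Section SliceTheory.

Variables (V W : lmodType K) (phi : {linear W -> K^o}) (lam : {linear V -> K^o}).

Let sl (w : W) : linear (fun v : V => (phi w : K) *: v).
Proof. by move=> a x y; rewrite scalerDr !scalerA mulrC. Qed.
Let sr (v : V) : linear (fun w : W => (phi w : K) *: v).
Proof. by move=> a x y; rewrite linearP scalerDl scalerA. Qed.
Let ll (w : W) : linear (fun v : V => (lam v : K) *: w).
Proof. by move=> a x y; rewrite linearP scalerDl scalerA. Qed.
Let lr (v : V) : linear (fun w : W => (lam v : K) *: w).
Proof. by move=> a x y; rewrite scalerDr !scalerA mulrC. Qed.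

Lemma sliceE (v : V) w : slice phi (tensor v w) = (phi w : K) *: v.
Proof. exact: (tens_liftE sl sr). Qed.

Lemma slice_linear : linear (@slice V W phi).
Proof. exact: (tens_lift_linear sl sr). Qed.

Lemma slicelE v (w : W) : slicel lam (tensor v w) = (lam v : K) *: w.
Proof. exact: (tens_liftE ll lr). Qed.

Lemma slicel_linear : linear (@slicel V W lam).
Proof. exact: (tens_lift_linear ll lr). Qed.

HB.instance Definition _ := GRing.isLinear.Build K _ _ _ (@slice V W phi) slice_linear.
HB.instance Definition _ := GRing.isLinear.Build K _ _ _ (@slicel V W lam) slicel_linear.

End SliceTheory.

Lemma tensor_suml V W (I : Type) (r : seq I) (F : I -> V) (w : W) :
  tensor (\sum_(i <- r) F i) w = \sum_(i <- r) tensor (F i) w.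
Proof. exact: (linear_sum (mklin (@tensor_linearl K V W w))). Qed.

Lemma tensor_sumr V W (I : Type) (r : seq I) (v : V) (F : I -> W) :
  tensor v (\sum_(i <- r) F i) = \sum_(i <- r) tensor v (F i).
Proof. exact: (linear_sum (mklin (@tensor_linearr K V W v))). Qed.

Lemma tensorZl V W a (v : V) (w : W) : tensor (a *: v) w = a *: tensor v w.
Proof. exact: (linearZZ (mklin (@tensor_linearl K V W w))). Qed.

Lemma tensorZr V W a (v : V) (w : W) : tensor v (a *: w) = a *: tensor v w.
Proof. exact: (linearZZ (mklin (@tensor_linearr K V W v))). Qed.

(** A dual basis for the finitely many right factors of a representative rewrites it with slices as
    left factors. *)
Lemma tens_slices V W (t : V ⊗ W) :
  exists D : seq ({linear W -> K^o} * W),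
    t = \sum_(d <- D) tensor (slice d.1 t) d.2.
Proof.
have [D DP] := dual_basis [seq p.2 | p <- repr t]; exists D.
have sliceD d : slice d t = \sum_(p <- repr t) (d p.2 : K) *: p.1.
  by rewrite {1}(tensorP t) linear_sum; apply: eq_bigr => p _; apply: sliceE.
under eq_bigr => d _ do rewrite sliceD tensor_suml.
rewrite exchange_big {1}(tensorP t) /= !big_seq; apply: eq_bigr => p pt.
rewrite {1}(DP p.2) ?map_f // tensor_sumr; apply: eq_bigr => d _.
by rewrite tensorZl tensorZr.
Qed.

(** Identities between tensors can thus be tested on vectors, one functional at a time. *)
Lemma tens_slice_inj V W (s t : V ⊗ W) :
  (forall phi : {linear W -> K^o}, slice phi s = slice phi t) -> s = t.
Proof.
move=> st; apply/eqP; rewrite -subr_eq0; apply/eqP.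
have [D ->] := tens_slices (s - t).
apply: big1 => d _; rewrite linearB /= st subrr.
by rewrite -(scale0r 0) tensorZl scale0r.
Qed.

Lemma slice_map V V' W (f : {linear V -> V'}) (phi : {linear W -> K^o}) (t : V ⊗ W) :
  slice phi (tens_map f id t) = f (slice phi t).
Proof.
apply: (tens_linear_ext (f := slice phi \o tens_map f idfun)
                        (g := f \o slice phi)); try exact: linearP.
by move=> v w /=; rewrite tens_mapE !sliceE linearZ.
Qed.

Lemma slicel_map V W W' (g : {linear W -> W'}) (lam : {linear V -> K^o}) (t : V ⊗ W) :
  slicel lam (tens_map id g t) = g (slicel lam t).
Proof.
apply: (tens_linear_ext (f := slicel lam \o tens_map idfun g)
                        (g := g \o slicel lam)); try exact: linearP.
by move=> v w /=; rewrite tens_mapE !slicelE linearZ.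
Qed.

Lemma slice_mapr V W W' (g : {linear W -> W'}) (phi : {linear W' -> K^o}) (t : V ⊗ W) :
  slice phi (tens_map id g t) = slice (phi \o g) t.
Proof.
apply: (tens_linear_ext (f := slice phi \o tens_map idfun g)
                        (g := slice (phi \o g))); try exact: linearP.
by move=> v w /=; rewrite tens_mapE !sliceE.
Qed.

Lemma slice_slicel V W (phi : {linear W -> K^o}) (lam : {linear V -> K^o}) (t : V ⊗ W) :
  phi (slicel lam t) = lam (slice phi t).
Proof.
apply: (tens_linear_ext (f := phi \o slicel lam)
                        (g := lam \o slice phi)); try exact: linearP.
by move=> v w /=; rewrite slicelE sliceE !linearZ; apply: mulrC.
Qed.

Lemma tens_unitr_map V W (phi : {linear W -> K^o}) (t : V ⊗ W) :
  tens_unitr (tens_map id phi t) = slice phi t.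
Proof.
have ul : linear (@tens_unitr K V).
  apply: tens_lift_linear => [b c w w'|w b c d].
    by rewrite scalerDr !scalerA mulrC.
  by rewrite scalerDl scalerA.
apply: (tens_linear_ext (f := mklin ul \o tens_map idfun phi)
                        (g := slice phi)); try exact: linearP.
by move=> v w /=; rewrite tens_mapE sliceE tens_unitrE.
Qed.

Lemma tens_assoc_linear U V W : linear (@tens_assoc K U V W).
Proof.
pose b (w' : W) (u' : U) (v' : V) := tensor u' (tensor v' w').
have bl w' v' : linear ((b w')^~ v') by move=> a u1 u2; rewrite /b tensor_linearl.
have br w' u' : linear (b w' u').
  by move=> a v1 v2; rewrite /b tensor_linearl tensor_linearr.
apply: tens_lift_linear => [w'|x].
  exact: (tens_lift_linear (bl w') (br w')).
move=> a w1 w2; rewrite /tens_lift scaler_sumr -big_split /=.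
by apply: eq_bigr => p _; rewrite !tensor_linearr.
Qed.

HB.instance Definition _ U V W :=
  GRing.isLinear.Build K _ _ _ (@tens_assoc K U V W) (@tens_assoc_linear U V W).

Lemma tens_assoc_ext U V W (T : lmodType K) (f g : (U ⊗ V) ⊗ W -> T) :
  linear f -> linear g ->
  (forall u v w, f (tensor (tensor u v) w) = g (tensor (tensor u v) w)) -> f =1 g.
Proof.
move=> lf lg fg; apply: tens_linear_ext => // x w.
apply: (tens_linear_ext (f := mklin lf \o mklin (@tensor_linearl K _ _ w))
  (g := mklin lg \o mklin (@tensor_linearl K _ _ w))); try exact: linearP.
by move=> u v; apply: fg.
Qed.

Lemma slice_assoc U V W (phi : {linear W -> K^o}) (x : (U ⊗ V) ⊗ W)
    (lam : {linear U -> K^o}) :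
  slice phi (slicel lam (tens_assoc x)) = slicel lam (slice phi x).
Proof.
apply: (tens_assoc_ext (f := slice phi \o (slicel lam \o @tens_assoc K U V W))
                        (g := slicel lam \o slice phi)); try exact: linearP.
move=> u v w /=; rewrite tens_assocE slicelE sliceE !linearZ /= sliceE slicelE.
by rewrite !scalerA mulrC.
Qed.

Lemma tens_assoc_map U U' V W (f : {linear U -> U'}) (x : (U ⊗ V) ⊗ W) :
  tens_map f id (tens_assoc x) = tens_assoc (tens_map (tens_map f id) id x).
Proof.
apply: (tens_assoc_ext (f := tens_map f idfun \o @tens_assoc K U V W)
   (g := @tens_assoc K U' V W \o tens_map (tens_map f idfun) idfun)); try exact: linearP.
by move=> u v w /=; rewrite tens_assocE !tens_mapE /= tens_mapE tens_assocE.
Qed.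

Lemma tens_map_comm V V' W W' (f : {linear V -> V'}) (g : {linear W -> W'}) (x : V ⊗ W) :
  tens_map f id (tens_map id g x) = tens_map id g (tens_map f id x).
Proof.
apply: (tens_linear_ext (f := tens_map f idfun \o tens_map idfun g)
   (g := tens_map idfun g \o tens_map f idfun)); try exact: linearP.
by move=> v w /=; rewrite !tens_mapE.
Qed.

End Slices.

(** * Subspaces as vector spaces *)

Section SubLmodule.

Variables (K : fieldType) (V : lmodType K).

Record subspace_type := SubspaceType {
  subspace_pred :> V -> Prop;
  subspace_predP : subspace subspace_pred }.

Definition sub_mem (N : subspace_type) : {pred V} := sub_pred N.

HB.instance Definition _ (N : subspace_type) := GRing.isSubmodClosed.Build K V
  (sub_mem N) (sub_pred_submod (subspace_predP N)).

Definition sub_type (N : subspace_type) := {x : V | x \in sub_mem N}.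

HB.instance Definition _ (N : subspace_type) := SubChoice.on (sub_type N).
HB.instance Definition _ (N : subspace_type) :=
  [SubChoice_isSubLmodule of sub_type N by <:].

Definition to_sub (N : subspace_type) x (Nx : N x) : sub_type N :=
  exist _ x (asboolT Nx).

Lemma sub_typeP (N : subspace_type) (x : sub_type N) : N (val x).
Proof. exact/asboolP/(valP x). Qed.

Definition sub_incl (N : subspace_type) : {linear sub_type N -> V} := \val.

End SubLmodule.

(** * Comodules as modules over the dual algebra *)

Section Comodules.

Variables (K : fieldType) (C : coalgebra K).
Implicit Types M X Y Z : comodule C.
Implicit Types phi psi : {linear C -> K^o}.

Definition act M phi : M -> M := slice phi \o coact M.

HB.instance Definition _ M phi := GRing.Linear.on (@act M phi).

Lemma act_counit M (m : M) : act (counit C) m = m.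
Proof. by rewrite /act /= -tens_unitr_map coact_counit. Qed.

Lemma comod_hom_act M X (f : comod_hom M X) phi m : f (act phi m) = act phi (f m).
Proof. by rewrite /act /= comod_funP slice_map. Qed.

(** Slicing the comodule condition by [phi] gives equivariance under [phi], and slices separate
    tensors. *)
Lemma act_comod_hom M X (f : {linear M -> X}) :
  (forall phi m, f (act phi m) = act phi (f m)) ->
  forall m, coact X (f m) = tens_map f id (coact M m).
Proof.
by move=> f_act m; apply: tens_slice_inj => phi; rewrite slice_map; apply/esym/f_act.
Qed.

Definition act_hom M X (f : {linear M -> X})
    (f_act : forall phi m, f (act phi m) = act phi (f m)) : comod_hom M X :=
  ComodHom (act_comod_hom f_act).

Lemma slice_slice (V : lmodType K) phi psi (x : (V ⊗ C) ⊗ C) :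
  slice phi (slice psi x) = slice (phi \o slice psi) (tens_assoc x).
Proof.
apply: (tens_assoc_ext (f := slice phi \o slice psi)
  (g := slice (phi \o slice psi) \o @tens_assoc K V C C)); try exact: linearP.
move=> v c c' /=; rewrite tens_assocE !sliceE !linearZ /= !sliceE scalerA.
by rewrite linearZ.
Qed.

(** The functional on the right is the convolution product of [phi] and [psi]; the identity is
    coassociativity, sliced twice. *)
Lemma act_act M phi psi (m : M) :
  act phi (act psi m) = act (phi \o (slice psi \o comul C)) m.
Proof.
rewrite /act /= -slice_map slice_slice coact_assoc.
exact: slice_mapr.
Qed.

Lemma act_linearl M (m : M) a phi psi (chi : {linear C -> K^o}) :
  (forall c, chi c = a *: phi c + psi c) ->
  act chi m = a *: act phi m + act psi m.
Proof.
move=> chiE; rewrite /act /=.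
pose h t := a *: slice phi t + slice psi t : M.
have lin_h : linear h.
  move=> b x y; rewrite /h !linearP /= addrACA !scalerA.
  by rewrite (mulrC a).
apply: (tens_linear_ext (f := slice chi) (g := h)) => //; first exact: linearP.
by move=> v c; rewrite /h !sliceE chiE scalerDl scalerA.
Qed.

Definition submod M (N : M -> Prop) := subspace N /\ stable (@act M) N.

Definition cyclic M (m : M) (v : M) := exists phi, v = act phi m.

Lemma cyclic_submod M (m : M) : submod (cyclic m).
Proof.
split; last by move=> phi _ [psi ->]; rewrite act_act; eexists.
split.
  have lin0 : linear (fun _ : C => 0 : K^o).
    by move=> a x y; rewrite scaler0 addr0.
  (* With all three functionals zero and scalar -1, [act_linearl] equates [act 0 m] with
     [- act 0 m + act 0 m]. *)
  exists (mklin lin0); rewrite (@act_linearl M m (-1) (mklin lin0) (mklin lin0)).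
    by rewrite scaleN1r addNr.
  by move=> c /=; rewrite scaler0 addr0.
move=> a _ _ [phi ->] [psi ->].
have lin_chi : linear (fun c => a *: phi c + psi c).
  move=> b x y; rewrite !linearP /= addrACA !scalerA.
  by rewrite (mulrC a).
exists (mklin lin_chi); apply: esym; exact: act_linearl.
Qed.

Lemma mem_cyclic M (m : M) : cyclic m m.
Proof. by exists (counit C); rewrite act_counit. Qed.

Lemma submod_zero M : submod (fun m : M => m = 0).
Proof. by split; [apply: subspace_zero | move=> phi _ ->; rewrite linear0]. Qed.

Lemma submod_add M (N T : M -> Prop) :
  submod N -> submod T -> submod (fun v => exists2 t, T t & N (v - t)).
Proof.
move=> [sN stN] [sT stT]; split; first exact: subspace_add.
move=> phi v [t Tt Nt]; exists (act phi t); first exact: stT.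
by rewrite -linearB; apply: stN.
Qed.

Lemma submod_preim M X (f : comod_hom M X) (N : X -> Prop) :
  submod N -> submod (fun m => N (f m)).
Proof.
move=> [sN stN]; split; last by move=> phi m Nm; rewrite comod_hom_act; apply: stN.
by split=> [|a x y Nx Ny]; rewrite ?linear0 ?linearP; case: sN => // _; apply.
Qed.

Lemma submod_im M X (f : comod_hom M X) (N : M -> Prop) :
  submod N -> submod (fun x => exists2 m, N m & x = f m).
Proof.
move=> [sN stN]; split.
  split; first by exists 0; rewrite ?linear0; case: sN.
  move=> a _ _ [m Nm ->] [m' Nm' ->]; exists (a *: m + m'); rewrite ?linearP //.
  by case: sN => _; apply.
move=> phi _ [m Nm ->]; exists (act phi m); last by rewrite comod_hom_act.
exact: stN.
Qed.

(** * Stable subspaces as comodules *)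

Section Subcomodule.

Variables (M : comodule C) (N : M -> Prop).
Hypothesis smN : submod N.

Let NT := SubspaceType (proj1 smN).
Let i := sub_incl NT.

(** Slices of [s] and [t] are vectors of [N], so they may be compared in [M]. *)
Let incl_inj W (s t : sub_type NT ⊗ W) : tens_map i id s = tens_map i id t -> s = t.
Proof.
move=> st; apply: tens_slice_inj => phi; apply: val_inj.
by move: (congr1 (slice phi) st); rewrite !slice_map.
Qed.

(** The coaction expands with its slices as left factors, and stability puts these in [N]. *)
Lemma subcoact_ex (n : sub_type NT) : exists t, tens_map i id t = coact M (val n).
Proof.
have [D ->] := tens_slices (coact M (val n)).
have sl d : NT (slice d (coact M (val n))).
  by apply: (proj2 smN); apply: (@sub_typeP K M NT n).
exists (\sum_(d <- D) tensor (to_sub (sl d.1)) d.2).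
rewrite (linear_sum (tens_map i idfun)); apply: eq_bigr => d _.
by rewrite [LHS]tens_mapE.
Qed.

(** The chosen lift is unique by [incl_inj], which makes the map linear and coassociative. *)
Definition subcoact (n : sub_type NT) := sval (cid (subcoact_ex n)).

Lemma subcoactE n : tens_map i id (subcoact n) = coact M (val n).
Proof. exact: svalP (cid (subcoact_ex n)). Qed.

Lemma subcoact_linear : linear subcoact.
Proof.
move=> a x y; apply: incl_inj; rewrite (linearP (tens_map i idfun)) /=.
rewrite (subcoactE x) (subcoactE y) [LHS]subcoactE.
by rewrite -linearP.
Qed.

Let sc := mklin subcoact_linear.

Lemma subcoact_assoc n :
  tens_assoc (tens_map sc id (sc n)) = tens_map id (comul C) (sc n).
Proof.
apply: incl_inj; rewrite tens_assoc_map tens_map_comm [in RHS]subcoactE.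
rewrite -(tens_map_comp (tens_map i idfun) sc (sc n)).
have -> : tens_map (tens_map i id \o sc) id (sc n) = tens_map (coact M \o i) id (sc n).
  by congr (tens_map _ _ _); apply/funext => x; apply: subcoactE.
by rewrite tens_map_comp subcoactE coact_assoc.
Qed.

Lemma subcoact_counit n : tens_unitr (tens_map id (counit C) (sc n)) = n.
Proof.
rewrite tens_unitr_map; apply: val_inj.
rewrite -[LHS](slice_map i) subcoactE.
exact: act_counit.
Qed.

Definition subcomodule : comodule C := Comodule subcoact_assoc subcoact_counit.

Definition subcomod_incl : comod_hom subcomodule M :=
  @ComodHom _ _ subcomodule M i (fun n => esym (subcoactE n)).

Lemma subcomod_incl_inj : injective subcomod_incl.
Proof. exact: val_inj. Qed.

Lemma subcomod_inclP (n : subcomodule) : N (subcomod_incl n).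
Proof. exact: (@sub_typeP K M NT n). Qed.

Definition to_subcomod x (Nx : N x) : subcomodule := @to_sub K M NT x Nx.

End Subcomodule.

(** * Coefficient maps *)

Section CoefficientMap.

Variables (X : comodule C) (lam : {linear X -> K^o}).

Lemma slicel_coact_act phi (x : X) :
  (slicel lam \o coact X : X -> coalg_comodule C) (act phi x) =
    act phi ((slicel lam \o coact X : X -> coalg_comodule C) x).
Proof.
rewrite /act /= -slicel_map -coact_assoc slice_assoc.
by rewrite slice_map.
Qed.

Definition coef_hom : comod_hom X (coalg_comodule C) :=
  @act_hom X (coalg_comodule C) (slicel lam \o coact X) slicel_coact_act.

Lemma coef_homE phi x : phi (coef_hom x) = lam (act phi x).
Proof. exact: slice_slicel. Qed.

Lemma counit_coef_hom x : counit C (coef_hom x) = lam x.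
Proof. by rewrite coef_homE act_counit. Qed.

(** Each [phi] sends [coef_hom x] to [lam (act phi x)], and [act phi x] stays in [N]. *)
Lemma coef_hom_vanish (N : X -> Prop) : submod N ->
  (forall x, N x -> lam x = 0) -> forall x, N x -> coef_hom x = 0.
Proof.
move=> [_ stN] lam0 x Nx; apply: functional_eq0 => phi.
by rewrite coef_homE lam0 //; apply: stN.
Qed.

End CoefficientMap.

Lemma hom_to_coalg_separates X (N : X -> Prop) x : submod N -> ~ N x ->
  exists f : comod_hom X (coalg_comodule C), (forall n, N n -> f n = 0) /\ f x <> 0.
Proof.
move=> smN nNx; have [lam [lamN lam1]] := separating_functional (proj1 smN) nNx.
exists (coef_hom lam); split; first exact: (coef_hom_vanish smN).
move/(congr1 (counit C)); rewrite counit_coef_hom lam1 linear0 => /eqP.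
by rewrite oner_eq0.
Qed.

(** * Subobjects and simple objects *)

Lemma zero_fun_linear (V W : lmodType K) : linear (fun _ : V => 0 : W).
Proof. by move=> a x y; rewrite scaler0 addr0. Qed.

Lemma zero_fun_act X Y phi x :
  mklin (@zero_fun_linear X Y) (act phi x) = act phi (mklin (@zero_fun_linear X Y) x).
Proof. by rewrite /= linear0. Qed.

Definition zero_hom X Y : comod_hom X Y := act_hom (@zero_fun_act X Y).

Lemma zero_objectP X : zero_object (A := comodules C) X <-> forall x : X, x = 0.
Proof.
split=> [X0 x|X0 Y].
  have [[f [_ fU]] _] := X0 X.
  have f0 := fU (zero_hom X X) I; have := fU (comod_id X) I; rewrite f0.
  by move=> /(congr1 (fun g : comod_hom X X => g x)) /= <-.
split; [exists (zero_hom X Y) | exists (zero_hom Y X)]; split=> // f _;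
  apply: comod_hom_eq => x /=; first by rewrite (X0 x) linear0.
by rewrite (X0 (f x)).
Qed.

(** The inclusion of the kernel and the zero map agree after composition with [f], so they are
    equal. *)
Lemma mono_injective X Y (f : comod_hom X Y) : mono (A := comodules C) f -> injective f.
Proof.
move=> mf x y fxy; apply/eqP; rewrite -subr_eq0; apply/eqP.
pose N x := f x = 0; have smN : submod N := submod_preim f (submod_zero Y).
have Nxy : N (x - y) by rewrite /N linearB fxy subrr.
have /(congr1 (fun g : comod_hom _ X => g (to_subcomod smN Nxy))) :
    subcomod_incl smN = zero_hom _ X.
  by apply: mf; apply: comod_hom_eq => z /=; rewrite linear0;
    exact: (subcomod_inclP (smN := smN) z).
exact.
Qed.

Lemma injective_mono X Y (f : comod_hom X Y) : injective f -> mono (A := comodules C) f.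
Proof.
move=> injf Z g h gh; apply: comod_hom_eq => z; apply: injf.
by move/(congr1 (fun k : comod_hom Z Y => k z)): gh.
Qed.

Lemma bijective_iso X Y (f : comod_hom X Y) :
  injective f -> (forall y, exists x, f x = y) -> iso (A := comodules C) f.
Proof.
move=> injf /choice[g gK].
have lin_g : linear g by move=> a x y; apply: injf; rewrite linearP !gK.
have g_act phi y : mklin lin_g (act phi y) = act phi (mklin lin_g y).
  by apply: injf; rewrite comod_hom_act /= !gK.
exists (act_hom g_act); split; apply: comod_hom_eq => x; last exact: gK.
by apply: injf; apply: gK.
Qed.

Lemma iso_surjective X Y (f : comod_hom X Y) :
  iso (A := comodules C) f -> forall y, exists x, f x = y.
Proof.
move=> [g [_ fg]] y; exists ((g : comod_hom Y X) y).
by move/(congr1 (fun k : comod_hom Y Y => k y)): fg.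
Qed.

Lemma simple_object_submod X (N : X -> Prop) x :
  simple_object (A := comodules C) X -> submod N -> N x -> x <> 0 -> forall y, N y.
Proof.
move=> [_ simX] smN Nx xn0 y.
case: (simX _ (subcomod_incl smN)).
- exact/injective_mono/subcomod_incl_inj.
- move/zero_objectP => /(_ (to_subcomod smN Nx)).
  by move=> /(congr1 (subcomod_incl smN)) /=.
- by move=> /iso_surjective/(_ y) [z <-]; apply: subcomod_inclP.
Qed.

(** If no member of the family were an isomorphism, all would be zero objects and factor through any
    one of them, which would then be an isomorphism. *)
Lemma simple_finitely_generated (A : category) (X : A) :
  simple_object X -> finitely_generated X.
Proof.
move=> [_ simX] J Y m [j0] mono_m dir cover; apply: contrapT => no_iso.
have Y0 j : zero_object (Y j).
  by case: (simX _ _ (mono_m j)) => // iso_m; case: no_iso; exists j.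
apply: no_iso; exists j0; apply: cover => // j.
have [[h _] [_ _]] := Y0 j (Y j0); exists h.
have [[z [_ zU]] _] := Y0 j X.
by rewrite -(zU (m j) Logic.I) (zU (compm (m j0) h) Logic.I).
Qed.

(** * Splitting maps from simple comodules *)

(** A map to [C] vanishing on [N] vanishes on all summands, hence is zero by uniqueness; but such
    maps separate [N] from outside vectors. *)
Lemma coproduct_submod (J : Type) (S : J -> comodule C) X
    (inj : forall j, comod_hom (S j) X) (N : X -> Prop) :
  is_coproduct (A := comodules C) inj -> submod N ->
  (forall j s, N (inj j s)) -> forall x, N x.
Proof.
move=> cop smN Ninj x; apply: contrapT => nNx.
have [f [fN fx]] := hom_to_coalg_separates smN nNx.
have [u [_ uU]] := cop (coalg_comodule C) (fun j => zero_hom _ _).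
apply: fx; rewrite -[f](uU f) ?(uU (zero_hom _ _)) // => j;
  by apply: comod_hom_eq => s /=; rewrite ?linear0 // fN.
Qed.

(* A maximal subcomodule missing [f s] is a complement of the simple image of [f]. *)
Lemma simple_hom_retraction (J : Type) (S : J -> comodule C) X Y
    (inj : forall j, comod_hom (S j) X) (f : comod_hom Y X) s :
  (forall j, simple_object (A := comodules C) (S j)) ->
  is_coproduct (A := comodules C) inj ->
  simple_object (A := comodules C) Y -> f s <> 0 ->
  exists h : comod_hom X Y, forall y, h (f y) = y.
Proof.
move=> simS cop simY fs.
have [sm0 st0] := submod_zero X.
have [N [sN stN _ nNfs maxN]] := maximal_avoiding sm0 st0 fs.
have smN : submod N by [].
have smY : submod (fun _ : Y => True) by [].
have Nf0 y : N (f y) -> y = 0.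
  move=> Nfy; apply: contrapT => yn0; apply: nNfs.
  exact: (simple_object_submod simY (submod_preim f smN) Nfy yn0).
have smT := submod_add smN (submod_im f smY).
have dec x : exists y, N (x - f y).
  suff [_ [y _ ->] Nxy] : exists2 t, (exists2 m, True & t = f m) & N (x - t).
    by exists y.
  apply: (coproduct_submod cop smT) => j.
  have [allN t|] := pselect (forall t, N (inj j t)).
    by exists 0; rewrite ?subr0 //; exists 0; rewrite ?linear0.
  move=> /existsNP[b nNb].
  have smS : submod (fun _ : S j => True) by [].
  have [sT stT] := submod_add smN (submod_im (inj j) smS).
  (* [N] plus the image of [S j] exceeds [N], so by maximality it contains [f s]. The component [c]
     is nonzero and maps into [N] plus the image of [f]; simplicity of [S j] then puts the whole
     image there. *)
  have [_ [c _ ->] Nc] : exists2 t, (exists2 m, True & t = inj j m) & N (f s - t).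
    apply: contrapT => nT; apply: nNb; apply: (maxN _ sT stT) => //.
      by move=> v Nv; exists 0; rewrite ?subr0 //; exists 0; rewrite ?linear0.
    by exists (inj j b); [exists b | rewrite subrr; case: sN].
  have cn0 : c <> 0 by move=> c0; apply: nNfs; move: Nc; rewrite c0 linear0 subr0.
  apply: (simple_object_submod (simS j) (submod_preim (inj j) smT) (x := c)) cn0.
  by exists (f s); [exists s | rewrite -opprB; apply: subspaceN].
have uni x y z : N (x - f y) -> N (x - f z) -> y = z.
  move=> Ny Nz; apply/eqP; rewrite -subr_eq0; apply/eqP/Nf0.
  rewrite linearB /=.
  have -> : f y - f z = (x - f z) - (x - f y) by rewrite opprB [RHS]addrC addrA subrK.
  exact: subspaceB.
(* [h x] is the only [y] with [x - f y] in [N]; uniqueness gives linearity and equivariance. *)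
have [h hP] := choice dec.
have lin_h : linear h.
  move=> a x y; apply: (uni (a *: x + y)) => //.
  by rewrite linearP opprD addrACA -scalerBr; case: sN => _; apply.
have h_act phi x : mklin lin_h (act phi x) = act phi (mklin lin_h x).
  by apply: (uni (act phi x)) => //=; rewrite comod_hom_act -linearB; apply: stN.
by exists (act_hom h_act) => y; apply: (uni (f y)) => //=; rewrite subrr; case: sN.
Qed.

Lemma cosemisimple_regular :
  cosemisimple C -> regular_object (A := comodules C) (coalg_comodule C).
Proof.
move=> css; exists {X : comodule C | simple_object (A := comodules C) X}, sval.
split; [split|].
- by move=> [X simX]; apply: simple_finitely_generated.
- move=> X Y f g fg; have [J [S [inj [simS cop]]]] := css X.
  have [u [_ uU]] := cop Y (fun j => compm f (inj j)).
  rewrite -(uU f) // -(uU g) // => j.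
  by rewrite (fg (exist _ (S j) (simS j))).
move=> [X simX] f /=.
have [[x fx]|f0] := pselect (exists x, (f : comod_hom X (coalg_comodule C)) x <> 0).
  have [J [S [inj [simS cop]]]] := css (coalg_comodule C).
  have [h hK] := simple_hom_retraction simS cop simX fx.
  by exists h; split; apply: comod_hom_eq => y /=; rewrite hK.
exists (zero_hom (coalg_comodule C) X); split; apply: comod_hom_eq => y //=.
rewrite linear0; apply: contrapT => fy; apply: f0; by exists y.
Qed.

(** * Consequences of regularity *)

Lemma subcomod_factor M Z (N : M -> Prop) (smN : submod N) (f : comod_hom Z M) :
  (forall z, N (f z)) ->
  factors_through (A := comodules C) f (subcomod_incl smN).
Proof.
move=> Nf; have inj_i := @subcomod_incl_inj _ _ smN.
pose g z := to_subcomod smN (Nf z).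
have lin_g : linear g by move=> a x y; apply: inj_i; rewrite linearP; apply: (linearP f).
have g_act phi z : mklin lin_g (act phi z) = act phi (mklin lin_g z).
  by apply: inj_i; rewrite comod_hom_act; apply: comod_hom_act.
by exists (act_hom g_act); apply: comod_hom_eq.
Qed.

(* The spanning vectors need not lie in [N]. *)
Definition fin_spanned M (N : M -> Prop) := exists s : seq M,
  forall T : M -> Prop, subspace T -> (forall x, x \in s -> T x) ->
  forall v, N v -> T v.

(** All vectors [act phi m] are combinations of the left factors in one representative of the
    coaction of [m]. *)
Lemma cyclic_fin_spanned M (m : M) : fin_spanned (cyclic m).
Proof.
exists [seq p.1 | p <- repr (coact M m)] => T sT Ts _ [phi ->].
rewrite /act /= (tensorP (coact M m)) linear_sum big_seq.
apply: subspace_sum => // p mp.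
by rewrite /= sliceE; apply: subspaceZ => //; apply: Ts; rewrite map_f.
Qed.

Lemma fin_spanned_add M (N T : M -> Prop) : fin_spanned N -> fin_spanned T ->
  fin_spanned (fun v => exists2 t, T t & N (v - t)).
Proof.
move=> [s sP] [t tP]; exists (s ++ t) => W sW Wst v [x Tx Nx].
rewrite -(subrK x v); apply: subspaceD => //.
  by apply: (sP) Nx => // y ys; apply: Wst; rewrite mem_cat ys.
by apply: (tP) Tx => // y yt; apply: Wst; rewrite mem_cat yt orbT.
Qed.

(** The finitely spanned subcomodules are directed under sums and cover [M], since each vector lies
    in its cyclic subcomodule; so one of them is [M]. *)
Lemma finitely_generated_fin_spanned M :
  finitely_generated (A := comodules C) M -> fin_spanned (fun _ : M => True).
Proof.
move=> fgM.
pose J := {N : M -> Prop | submod N /\ fin_spanned N}.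
pose mkJ N (smN : submod N) (fsN : fin_spanned N) : J := exist _ N (conj smN fsN).
pose sm (j : J) := proj1 (svalP j).
have [||i j|Z n mono_n fac|j iso_j] := fgM J _ (fun j => subcomod_incl (sm j)).
- constructor; exists (cyclic 0).
  by split; [apply: cyclic_submod | apply: cyclic_fin_spanned].
- by move=> j; apply/injective_mono/subcomod_incl_inj.
- case: (i) (j) => [Ni [smi fi]] [Nj [smj fj]].
  exists (mkJ _ (submod_add smi smj) (fin_spanned_add fi fj)).
  split; apply: subcomod_factor => z /=.
    exists 0; first by case: smj => -[].
    by rewrite subr0; apply: (subcomod_inclP (smN := smi)).
  exists (subcomod_incl smj z); first exact: (subcomod_inclP (smN := smj)).
  by rewrite subrr; case: smi => -[].
- apply: bijective_iso; first exact: mono_injective.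
  move=> y.
  have [h /(congr1 (fun f : comod_hom _ M => f (to_subcomod _ (mem_cyclic y))))] :=
    fac (mkJ _ (cyclic_submod y) (cyclic_fin_spanned y)).
  by move=> /= yE; eexists; apply/esym: yE.
have [s sP] := proj2 (svalP j); exists s => T sT Ts v _.
have [z <-] := iso_surjective iso_j v.
by apply: (sP) => //; apply: (subcomod_inclP (smN := sm j)).
Qed.

(** A dual basis modulo [N] on spanning vectors has functionals whose common zeros in [U] are
    exactly [N]. An endomorphism fixing [N] whose values are killed by all their coefficient maps is
    thus a projection onto [N]; it is built from the identity by induction on the list. *)
Lemma regular_complement (U : comodule C) (N : U -> Prop) :
  regular_wrt (A := comodules C) U (coalg_comodule C) ->
  fin_spanned (fun _ : U => True) -> submod N ->
  exists p : comod_hom U U, (forall u, N (p u)) /\ (forall n, N n -> p n = n).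
Proof.
move=> reg [s sP] smN.
have [D [DN Ds]] := dual_basis_mod s (proj1 smN).
suff [p [pD pN]] : exists p : comod_hom U U,
    (forall u, all (fun d : {linear U -> K^o} * U => coef_hom d.1 (p u) == 0) D) /\
    (forall n, N n -> p n = n).
  exists p; split=> // u.
  have : N (p u - dual_sum D (p u)).
    apply: (sP (fun v => N (v - dual_sum D v))) => //.
    split=> [|a x y Nx Ny].
      by rewrite (linear0 (mklin (dual_sum_linear D)) : dual_sum D 0 = 0) subr0;
        case: smN => -[].
    rewrite dual_sum_linear opprD addrACA -scalerBr.
    by case: smN => -[_ NP] _; apply: NP.
  rewrite dual_sum0 ?subr0 //; apply: sub_all (pD u) => d /eqP d0.
  by rewrite -counit_coef_hom d0 linear0.
elim: D {Ds} DN => [|[lam w] D IHD] DN.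
  by exists (comod_id U).
have [n /DN /andP[]//|p [pD pN]] := IHD.
(* With [f = coef_hom lam \o p], the map [q = p (1 - h f) p] goes into the kernel of
   [coef_hom lam] since [f = f h f], and it fixes [N] since [f] vanishes there. *)
pose f := comod_comp (coef_hom lam) p.
have [h [fhf _]] := reg f; change (comod_hom (coalg_comodule C) U) in h.
have fhfE x : f x = f (h (f x)).
  by rewrite {1}fhf.
have lin_q : linear (fun u => p (p u - h (f (p u)))).
  move=> a x y; rewrite -linearP; congr (p _).
  by rewrite !linearP addrACA -scalerDr.
have q_act phi u : mklin lin_q (act phi u) = act phi (mklin lin_q u).
  rewrite -[LHS]/(p (p (act phi u) - h (f (p (act phi u))))).
  rewrite (comod_hom_act p phi u) (comod_hom_act f) (comod_hom_act h).
  by rewrite -linearB comod_hom_act.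
exists (act_hom q_act); split=> [u|n Nn].
  apply/andP; split; last exact: pD.
  rewrite -[X in X == _]/(f (p u - h (f (p u)))).
  by rewrite (linearB f) -fhfE subrr.
rewrite -[LHS]/(p (p n - h (coef_hom lam (p (p n))))) !(pN n Nn).
have lam0 x : N x -> lam x = 0 by move=> /DN /andP[/eqP].
by rewrite (coef_hom_vanish smN lam0 Nn) linear0 subr0 pN.
Qed.

(** Simplicity is tested inside [X]: a subcomodule of [X] meeting [S] nontrivially contains it. *)
Definition simple_sub X (S : X -> Prop) :=
  [/\ submod S, exists2 x, S x & x <> 0 & forall T : X -> Prop, submod T ->
    forall y, S y -> T y -> y <> 0 -> forall z, S z -> T z].

Lemma simple_sub_object X (S : X -> Prop) (simS : simple_sub S) (smS : submod S) :
  simple_object (A := comodules C) (subcomodule smS).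
Proof.
case: simS => _ [x Sx xn0] simS; split.
  by move=> /zero_objectP /(_ (to_subcomod smS Sx)) /(congr1 (subcomod_incl smS)).
move=> Y m /mono_injective injm.
have [Y0|] := pselect (forall y, (m : comod_hom _ _) y = 0).
  left; apply/zero_objectP => y; apply: injm.
  by rewrite Y0 linear0.
move=> /existsNP[y my]; right; apply: bijective_iso => // z.
pose im := comod_comp (subcomod_incl smS) m.
have smY : submod (fun _ : Y => True) by [].
have [v _ vE] : exists2 v, True & subcomod_incl smS z = im v.
  apply: (simS _ (submod_im im smY) (im y)); try exact: subcomod_inclP.
    by exists y.
  by rewrite -(linear0 (subcomod_incl smS)) => /subcomod_incl_inj.
by exists v; apply: subcomod_incl_inj.
Qed.

(* If [T] misses some [u a], take [N] maximal above its preimage with [a] not in [N];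
   the component [b] of [a] in a complement of [N] generates a simple subcomodule,
   whose image under [u] is simple and not contained in [T]. *)
Lemma regular_socle X (T : X -> Prop) :
  regular_object (A := comodules C) (coalg_comodule C) -> submod T ->
  (forall S : X -> Prop, simple_sub S -> forall x, S x -> T x) -> forall x, T x.
Proof.
move=> [I [U [[fgU genU] reg]]] smT Tsoc x; apply: contrapT => nTx.
have [f [fT fx]] := hom_to_coalg_separates smT nTx.
(* If every map from a generator landed in [T], then [f] would vanish on all of them and be zero. *)
have [i [u [a nTa]]] : exists i (u : comod_hom (U i) X) a, ~ T (u a).
  apply: contrapT => no; apply: fx.
  have -> : f = zero_hom X _ => //.
  apply: (genU X) => i u; apply: comod_hom_eq => a /=; apply: fT.
  by apply: contrapT => nT; apply: no; exists i, u, a.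
have [sN stN] := submod_preim u smT.
have [N [sN' stN' TN nNa maxN]] := maximal_avoiding sN stN nTa.
have smN : submod N by [].
have [p [pN pid]] :=
  regular_complement (reg i) (finitely_generated_fin_spanned (fgU i)) smN.
pose b := a - p a.
have pb : p b = 0 by rewrite /b linearB /= (pid (p a)) // subrr.
have nNb : ~ N b.
  move=> Nb; apply: nNa; rewrite -(subrK (p a) a).
  exact: subspaceD.
have nTb : ~ T (u b) by move/TN.
have pS c : cyclic b c -> p c = 0.
  by move=> [phi ->]; rewrite comod_hom_act pb linear0.
apply: nTb; apply: (Tsoc (fun y => exists2 c, cyclic b c & y = u c)); last first.
  by exists b => //; apply: mem_cyclic.
split; first exact/submod_im/cyclic_submod.
  exists (u b); first by exists b => //; apply: mem_cyclic.
  by move=> ub0; apply: nNb; apply: TN; rewrite ub0; case: smT => -[].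
move=> W smW _ [c bc ->] Wc cn0 _ [d bd ->].
pose W' e := cyclic b e /\ W (u e).
have smW' : submod W'.
  have [[b0 bP] bst] := cyclic_submod b; have [[w0 wP] wst] := submod_preim u smW.
  split; first by split=> [//|k y z [? ?] [? ?]]; split; [apply: bP | apply: wP].
  by move=> phi y [? ?]; split; [apply: bst | apply: wst].
have [sNW stNW] := submod_add smN smW'.
(* If [N + W'] missed [a], maximality would put [c] in [N], where [p] is the identity; but
   [p c = 0]. *)
have [t [bt Wt] Nt] : exists2 t, W' t & N (a - t).
  apply: contrapT => nNW; apply: cn0.
  have Nc : N c.
    apply: (maxN _ sNW stNW) => // [v Nv|].
      by exists 0; rewrite ?subr0 //; case: smW' => -[].
    by exists c => //; rewrite subrr; case: sN'.
  by rewrite -(pid c Nc) pS // linear0.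
(* As [a - t] lies in [N] and [p t = 0], applying [p] gives [p a = a - t]. *)
have tE : b = t.
  have := pid _ Nt; rewrite linearB /= (pS t) // subr0 /b => ->.
  by rewrite opprB addrC subrK.
case: bd => phi ->; rewrite comod_hom_act; apply: (proj2 smW).
by rewrite tE.
Qed.

(** * Decomposition into simple subcomodules *)

Lemma big_seq_subset (V : zmodType) (T : eqType) (s t : seq T) (e : T -> V) :
  uniq s -> uniq t -> {subset s <= t} -> (forall i, i \notin s -> e i = 0) ->
  \sum_(i <- t) e i = \sum_(i <- s) e i.
Proof.
move=> us ut st e0; rewrite (bigID (mem s)) /= [X in _ + X]big1 // addr0.
rewrite -big_filter; apply: perm_big; apply: uniq_perm => //.
  exact: filter_uniq.
by move=> i; rewrite mem_filter andb_idr //; apply: st.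
Qed.

Section Decomposition.

Variable X : comodule C.
(** Classical equality on predicates allows duplicate-free sequences of subcomodules. *)
Let T : eqType := {classic (X -> Prop)}.
Implicit Types (F : set T) (S : T) (s t : seq T) (e : T -> X) (x y : X).

Definition independent F := forall s e, uniq s ->
  (forall S, S \in s -> F S) -> (forall S, S \in s -> (S : X -> Prop) (e S)) ->
  \sum_(S <- s) e S = 0 -> forall S, S \in s -> e S = 0.

(** Requiring [e] to vanish off [s] lets decompositions with different supports be compared as
    functions. *)
Definition decomposition F s e x :=
  [/\ uniq s, forall S, S \in s -> F S, forall S, S \in s -> (S : X -> Prop) (e S),
      forall S, S \notin s -> e S = 0 & x = \sum_(S <- s) e S].

Section Family.

Variable F : set T.
Hypothesis submodF : forall S, F S -> submod (S : X -> Prop).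

Lemma decomposition_subset s t e x : decomposition F s e x ->
  uniq t -> (forall S, S \in t -> F S) -> {subset s <= t} -> decomposition F t e x.
Proof.
move=> [us Fs es e0 ->] ut Ft st; split=> //.
- move=> S St; have [/es //|/e0 ->] := boolP (S \in s).
  by case: (submodF (Ft S St)) => -[].
- by move=> S St; apply: e0; apply: contra St => /st.
- by rewrite (big_seq_subset us ut st e0).
Qed.

Lemma decomposition_linear a s t e f x y :
  decomposition F s e x -> decomposition F t f y ->
  decomposition F (undup (s ++ t)) (fun S => a *: e S + f S) (a *: x + y).
Proof.
move=> dx dy.
have Fst S : S \in undup (s ++ t) -> F S.
  rewrite mem_undup mem_cat; case: dx dy => _ Fs _ _ _ [_ Ft _ _ _].
  by move=> /orP[/Fs|/Ft].
have [|_ _ es e0 ->] := decomposition_subset dx (undup_uniq (s ++ t)) Fst.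
  by move=> S Ss; rewrite mem_undup mem_cat Ss.
have [|us _ fs f0 ->] := decomposition_subset dy (undup_uniq (s ++ t)) Fst.
  by move=> S St; rewrite mem_undup mem_cat St orbT.
split=> //.
- move=> S Sst; have [[_ SP] _] := submodF (Fst _ Sst).
  by apply: SP; [apply: es | apply: fs].
- by move=> S Sst; rewrite e0 // f0 // scaler0 addr0.
- by rewrite scaler_sumr -big_split.
Qed.

Lemma decomposition_act phi s e x :
  decomposition F s e x -> decomposition F s (fun S => act phi (e S)) (act phi x).
Proof.
move=> [us Fs es e0 ->]; split=> //.
- by move=> S Ss; have [_ st] := submodF (Fs _ Ss); apply: st; apply: es.
- by move=> S /e0 ->; rewrite linear0.
- by rewrite linear_sum.
Qed.

Lemma decomposition1 S x : F S -> (S : X -> Prop) x ->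
  decomposition F [:: S] (fun S' => if S' == S then x else 0) x.
Proof.
move=> FS Sx; split=> //.
- by move=> S'; rewrite inE => /eqP->.
- by move=> S'; rewrite inE => /eqP->; rewrite eqxx.
- by move=> S'; rewrite inE => /negbTE->.
- by rewrite big_seq1 eqxx.
Qed.

(** The difference of the two is a decomposition of 0. *)
Lemma decomposition_uniq s t e f x : independent F ->
  decomposition F s e x -> decomposition F t f x -> e =1 f.
Proof.
move=> indF dx dy S; have := decomposition_linear (-1) dx dy.
rewrite scaleN1r addNr => -[us Fs es e0 /esym s0].
suff : -1 *: e S + f S = 0 by rewrite scaleN1r addrC => /eqP; rewrite subr_eq0 => /eqP.
by have [/(indF _ _ us Fs es s0)|/e0] := boolP (S \in undup (s ++ t)).
Qed.

Definition family_sum x := exists s e, decomposition F s e x.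

Lemma family_sum_submod : submod family_sum.
Proof.
split; last first.
  by move=> phi x [s [e d]]; do 2 eexists; apply: (decomposition_act phi d).
split.
  by exists [::], (fun _ => 0); split=> //; rewrite big_nil.
by move=> a x y [s [e d]] [t [f d']]; do 2 eexists; apply: (decomposition_linear a d d').
Qed.

Lemma mem_family_sum S x : F S -> (S : X -> Prop) x -> family_sum x.
Proof. by move=> FS Sx; do 2 eexists; apply: decomposition1 FS Sx. Qed.

End Family.

(** Zorn's lemma: a simple subcomodule not contained in the sum meets it trivially, so adjoining it
    keeps the family independent. *)
Lemma maximal_independent : exists F, [/\ forall S, F S -> simple_sub (S : X -> Prop),
  independent F & forall S, simple_sub (S : X -> Prop) ->
    forall x, (S : X -> Prop) x -> family_sum F x].
Proof.
pose good F := (forall S, F S -> simple_sub (S : X -> Prop)) /\ independent F.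
have [H sub_H tot_H|F [[simF indF] maxF]] := @Zorn_bigcup T good.
  split; first by move=> S [F /sub_H[simF _]]; apply: simF.
  move=> s e us Fs es s0 S Ss.
  (* A finite sequence from the union of a chain lies in a single member. *)
  have [F HF sF] : exists2 F, H F & forall S, S \in s -> F S.
    have [F0 HF0 _] := Fs _ Ss.
    elim: s {us es s0 S Ss} Fs => [|S s IHs] Fs; first by exists F0.
    have [S' S's|F1 H1 F1s] := IHs; first by apply: Fs; rewrite inE S's orbT.
    have [F2 H2 F2S] := Fs S (mem_head _ _).
    have [F12|F21] := tot_H _ _ H1 H2; [exists F2 | exists F1] => // S';
      rewrite inE => /orP[/eqP->|/F1s] //; [exact: F12 | exact: F21].
  by have [_ indF] := sub_H _ HF; apply: (indF s e).
have smF S : F S -> submod (S : X -> Prop) by move/simF => [].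
exists F; split=> // S simS x Sx; apply: contrapT => nFx.
have [smsum stsum] := family_sum_submod smF.
have nFS : ~ F S by move=> FS; apply/nFx/(mem_family_sum FS).
apply: (maxF (fun S' => F S' \/ S' = S)).
  by split=> [S' ?|/(_ S (or_intror erefl)) //]; left.
split; first by move=> S' [/simF|->].
move=> s e us Fs es s0.
have Fin S' : S' \in s -> S' != S -> F S' by move=> /Fs [//|->]; rewrite eqxx.
have [Ss|nSs] := boolP (S \in s); last first.
  apply: indF => // S' S's; apply: Fin => //.
  by apply: contraNneq nSs => <-.
have uS : uniq (rem S s) by rewrite rem_uniq.
have memr S' : S' \in rem S s -> S' \in s /\ F S'.
  by rewrite mem_rem_uniq // inE => /andP[S'S S's]; split=> //; apply: Fin.
have sE : \sum_(S' <- s) e S' = e S + \sum_(S' <- rem S s) e S'.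
  by rewrite (perm_big _ (perm_to_rem Ss)) big_cons.
(* [e S] is minus the sum of the other terms; were it nonzero, the family sum would contain all of
   [S], including [x]. *)
have eS0 : e S = 0.
  apply: contrapT => eSn0; apply: nFx.
  case: simS => _ _ simS; apply: (simS _ (conj smsum stsum) (e S)) => //; first exact: es.
  move/eqP: s0; rewrite sE addr_eq0 => /eqP ->; apply: subspaceN => //.
  rewrite big_seq; apply: subspace_sum => // S' /memr[S's FS'].
  by apply: (mem_family_sum FS'); apply: es.
move=> S' S's; have [->//|S'S] := eqVneq S' S.
apply: (indF _ _ uS) => [S1 /memr[]//|S1 /memr[S1s _]||]; first exact: es.
  by move: s0; rewrite sE eS0 add0r.
by rewrite mem_rem_uniq // inE S'S.
Qed.

End Decomposition.

(** A maximal independent family sums to [X]. The universal map applies the given maps to the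
    components of a chosen decomposition; independence makes the result free of that choice. *)
Lemma socle_coproduct X :
  (forall N : X -> Prop, submod N ->
    (forall S : X -> Prop, simple_sub S -> forall x, S x -> N x) -> forall x, N x) ->
  exists (J : Type) (S : J -> comodule C) (inj : forall j, comod_hom (S j) X),
    (forall j, simple_object (A := comodules C) (S j)) /\
    is_coproduct (A := comodules C) inj.
Proof.
move=> soc; have [F [simF indF sumF]] := maximal_independent X.
have smF S : F S -> submod (S : X -> Prop) by move/simF => [].
have dec := soc _ (family_sum_submod smF) sumF.
pose sm (j : {S | F S}) := smF _ (svalP j).
exists {S | F S}, (fun j => subcomodule (sm j)), (fun j => subcomod_incl (sm j)).
split; first by move=> j; apply: simple_sub_object; apply/simF/(svalP j).
move=> Z g0.
(* Retyping the family as comodule maps lets its members be applied to vectors. *)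
have [g gE] : exists g : forall j, comod_hom (subcomodule (sm j)) Z, g = g0.
  by exists g0.
rewrite -{}gE {g0}.
(* Extension by 0 outside [F] and outside [S], so that sums over sequences carry no membership
   proofs. *)
pose gg (S : {classic (X -> Prop)}) (x : X) : Z :=
  if pselect (F S) is left FS then
    if pselect ((S : X -> Prop) x) is left Sx then
      g (exist _ S FS) (to_subcomod (sm (exist _ S FS)) Sx)
    else 0
  else 0.
have ggE S (FS : F S) x (Sx : (S : X -> Prop) x) :
    gg S x = g (exist _ S FS) (to_subcomod (sm (exist _ S FS)) Sx).
  rewrite /gg; case: pselect => // FS'; case: pselect => // Sx'.
  by rewrite (Prop_irrelevance FS' FS) (Prop_irrelevance Sx' Sx).
have gg_lin S a x y : F S -> (S : X -> Prop) x -> (S : X -> Prop) y ->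
    gg S (a *: x + y) = a *: gg S x + gg S y.
  move=> FS Sx Sy; have [[_ SP] _] := smF S FS.
  have Sxy := SP a x y Sx Sy.
  rewrite !ggE -linearP; congr (g _ _).
  by apply: subcomod_incl_inj; rewrite linearP.
have gg_act S phi x : F S -> (S : X -> Prop) x -> gg S (act phi x) = act phi (gg S x).
  move=> FS Sx; have [_ st] := smF S FS.
  have Sphi := st phi x Sx.
  rewrite !ggE -comod_hom_act; congr (g _ _).
  by apply: subcomod_incl_inj; rewrite comod_hom_act.
have gg0 S : gg S 0 = 0.
  rewrite /gg; case: pselect => // FS; case: pselect => // S0.
  rewrite -[RHS](linear0 (g (exist _ S FS))); congr (g _ _).
  by apply: subcomod_incl_inj; rewrite linear0.
have /choice[d dP] : forall x, exists p : seq {classic (X -> Prop)} *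
    ({classic (X -> Prop)} -> X), decomposition F p.1 p.2 x.
  by move=> x; have [s [e dx]] := dec x; exists (s, e).
pose u x := \sum_(S <- (d x).1) gg S ((d x).2 S).
(* Components agree by uniqueness; the two sums are compared over the union of the supports. *)
have uE s e x : decomposition F s e x -> u x = \sum_(S <- s) gg S (e S).
  move=> dx; have fe := decomposition_uniq smF indF (dP x) dx.
  rewrite /u (funext fe); case: (dx) (dP x) => us _ _ e0 _ [ut _ _ f0 _].
  rewrite -(big_seq_subset us (undup_uniq (s ++ (d x).1))).
  - rewrite -(big_seq_subset ut (undup_uniq (s ++ (d x).1))) //.
      by move=> S St; rewrite mem_undup mem_cat St orbT.
    by move=> S St; rewrite -fe f0.
  - by move=> S Ss; rewrite mem_undup mem_cat Ss.
  - by move=> S Ss; rewrite e0.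
have lin_u : linear u.
  move=> a x y; rewrite (uE _ _ _ (decomposition_linear smF a (dP x) (dP y))).
  have [us Fs _ _ _] := decomposition_linear smF a (dP x) (dP y).
  have dx : decomposition F (undup ((d x).1 ++ (d y).1)) (d x).2 x.
    apply: decomposition_subset (dP x) us Fs _ => // S Ss.
    by rewrite mem_undup mem_cat Ss.
  have dy : decomposition F (undup ((d x).1 ++ (d y).1)) (d y).2 y.
    apply: decomposition_subset (dP y) us Fs _ => // S Ss.
    by rewrite mem_undup mem_cat Ss orbT.
  rewrite (uE _ _ _ dx) (uE _ _ _ dy) scaler_sumr -big_split.
  apply: eq_big_seq => S Ss; case: dx dy => _ _ xs _ _ [_ _ ys _ _].
  by apply: gg_lin; [apply: Fs | apply: xs | apply: ys].
have u_act phi x : mklin lin_u (act phi x) = act phi (mklin lin_u x).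
  rewrite /= (uE _ _ _ (decomposition_act smF phi (dP x))) /u linear_sum.
  by apply: eq_big_seq => S Ss; case: (dP x) => _ Fs xs _ _;
    apply: gg_act; [apply: Fs | apply: xs].
exists (act_hom u_act); split.
  move=> [S FS]; apply: comod_hom_eq => x.
  have Sx := subcomod_inclP x.
  rewrite [LHS](uE _ _ _ (decomposition1 FS Sx)) big_seq1 eqxx ggE; congr (g _ _).
  exact: subcomod_incl_inj.
move=> v vg; apply: comod_hom_eq => x; rewrite /= /u.
have [_ Fs xs _ xE] := dP x.
rewrite [in RHS]xE linear_sum; apply: eq_big_seq => S Ss.
rewrite (ggE S (Fs S Ss) _ (xs S Ss)).
by rewrite -(vg (exist _ S (Fs S Ss))).
Qed.

Lemma regular_cosemisimple :
  regular_object (A := comodules C) (coalg_comodule C) -> cosemisimple C.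
Proof. by move=> reg X; apply: socle_coproduct => N; apply: regular_socle. Qed.

End Comodules.

Theorem theorem5p1 (K : fieldType) (C : coalgebra K) :
  regular_object (A := comodules C) (coalg_comodule C) <-> cosemisimple C.
Proof. by split; [apply: regular_cosemisimple | apply: cosemisimple_regular]. Qed.
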